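(* Let $X$ and $Y$ be metric spaces, where $Y$ has no isolated points, and let $f : X \to Y$ be a continuous surjective map. Then $f$ is $H$-covering if and only if $f$ is stable.
   Context: All spaces are metric; all maps are continuous and onto; $Y$ has no isolated points. $N^{+}$ denotes the set of positive integers. **Stable maps.** A map $f : X \to Y$ is called stable if to each point $y \in Y$ one can assign a nonempty family $\eta_y$ of subsets of $X$ such that every $U \in \eta_y$ satisfies $U \cap f^{-1}(y) \neq \emptyset$, and the following holds: for every $y\in Y$, every $U \in \eta_y$ and every open set $V \subset X$ with $V \supset U \cap f^{-1}(y)$, there exists a neighborhood $O(y)$ of $y$ in $Y$ such that $V \in \eta_w$ for every $w \in O(y)$. **Canonical compacta.** For $y \in Y$ and a countable ordinal $\alpha$ with $1 \le \alpha < \omega_1$, the canonical compacta $S_\alpha(y) \subset Y$, and the associated sub-compacta $S_\alpha^{*}(y) \subset S_\alpha(y)$, are defined by transfinite recursion. A canonical compact is understood together with the choices used to construct it; all choices of the kind described are permitted. In each case one chooses a sequence $D_y = \{y_i : i \in N^{+}\}$ of pairwise distinct points of $Y$ converging to $y$, and pairwise disjoint neighborhoods $O(y_i)$ of the points $y_i$ with $\operatorname{diam}(O(y_i)) < 1/i$ and $y \notin O(y_i)$. An infinite subsequence of $D_y$ is written $D_y^{*} = \{y_{i_k} : k \in N^{+}\}$ with $i_1 < i_2 < \cdots$. - Rank $1$: $S_1(y) = \{y\} \cup D_y$, and $S_1^{*}(y) = \{y\} \cup D_y^{*}$ for any infinite subsequence $D_y^{*}$ of $D_y$. - Successor step $\alpha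 = \beta + 1$ (with $\beta \ge 1$): for each $i$ choose a canonical compact $S_\beta(y_i) \subset O(y_i)$ and put $S_{\beta+1}(y) = \{y\} \cup \bigcup_{i} S_\beta(y_i)$. A set $S_{\beta+1}^{*}(y)$ is any set of the form $\{y\} \cup \bigcup_{k} S_\beta^{*}(y_{i_k})$, where $D_y^{*}=\{y_{i_k}\}$ is an infinite subsequence of $D_y$ and each $S_\beta^{*}(y_{i_k}) \subset S_\beta(y_{i_k})$ is an associated sub-compact of the chosen $S_\beta(y_{i_k})$. - Limit step ($\alpha$ a limit ordinal): let $\{\beta_i\}_{i \in N^{+}}$ be an increasing sequence of ordinals with $1 \le \beta_i < \alpha$; for each $i$ choose a canonical compact $S_{\beta_i}(y_i) \subset O(y_i)$ and put $S_\alpha(y) = \{y\} \cup \bigcup_{i} S_{\beta_i}(y_i)$. A set $S_\alpha^{*}(y)$ is any set of the form $\{y\} \cup \bigcup_{k} S_{\beta_{i_k}}^{*}(y_{i_k})$, where $\{y_{i_k}\}$ is an infinite subsequence of $D_y$ and each $S_{\beta_{i_k}}^{*}(y_{i_k})\subset S_{\beta_{i_k}}(y_{i_k})$ is an associated sub-compact of the chosen $S_{\beta_{i_k}}(y_{i_k})$. **$H$-covering maps.** A map $f : X \to Y$ is $H_\alpha$-covering if for every $y\in Y$ and every canonical compact $S_\alpha(y)$ there exist an associated $S_\alpha^{*}(y)$ and a set $K \subset X$ such that the restriction $f|_K : K \to S_\alpha^{*}(y)$ is a homeomorphism. A map is $H$-covering if it is $H_\alpha$-covering for every $\alpha$ with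 $1 \le \alpha < \omega_1$. *)

(* Defs.v *)
From HB Require Import structures.
From mathcomp Require Import all_boot all_order all_algebra.
From mathcomp Require Import all_classical all_reals all_analysis.
From mathcomp Require wochoice.

Set Implicit Arguments.
Unset Strict Implicit.
Unset Printing Implicit Defensive.

Import Order.TTheory GRing.Theory Num.Theory.

Local Open Scope order_scope.
Local Open Scope classical_set_scope.

(* The ordinal omega_1 is realized as the set of those elements of a           *)
(* well-ordered uncountable type whose initial segment is countable. The       *)
(* lemmas omega1_least, omega1_countable and omega1_uncountable show that      *)
(* this is an uncountable well-order with countable initial segments; these    *)
(* properties determine omega_1 up to order isomorphism, so that the elements  *)
(* of omega1 are (copies of) the ordinals alpha < omega_1.                     *)

Definition wo_le : rel (set nat) :=
  sval (wochoice.well_ordering_principle (set nat)).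

Lemma wo_leP : wochoice.well_order wo_le.
Proof. exact: (svalP (wochoice.well_ordering_principle (set nat))). Qed.

Definition omega1 := set_type [set a | countable [set b | wo_le b a]].

HB.instance Definition _ := Choice.on omega1.

Definition omega1_le : rel omega1 := fun a b => wo_le (val a) (val b).

Lemma wo_chainT : wochoice.wo_chain wo_le predT.
Proof. by move=> A _; exact: wo_leP. Qed.

Lemma wo_le_min (A : set (set nat)) :
  A !=set0 -> exists2 a, A a & forall b, A b -> wo_le a b.
Proof.
move=> [x Ax].
have [|z [[zA lbz] _]] := @wo_leP (fun a => `[< A a >]).
  by exists x; apply/asboolP.
by exists z; [exact/asboolP|move=> b Ab; apply: lbz; exact/asboolP].
Qed.

Lemma wo_le_total : total wo_le.
Proof. by move=> x y; exact: (wochoice.wo_chainW wo_chainT). Qed.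

Lemma wo_le_anti : antisymmetric wo_le.
Proof.
by move=> x y; exact: (wochoice.wo_chain_antisymmetric wo_chainT).
Qed.

Lemma wo_le_trans : transitive wo_le.
Proof.
move=> y x z xy yz.
have [|a sa lba] := @wo_le_min [set x; y; z]; first by exists x; left; left.
case: sa lba => [[->|->]|->] lba; first by apply: lba; right.
- have yx : wo_le y x by apply: lba; left; left.
  by rewrite (@wo_le_anti x y) // xy yx.
- have zy : wo_le z y by apply: lba; left; right.
  by rewrite -(@wo_le_anti y z) // yz zy.
Qed.

Lemma omega1_le_anti : antisymmetric omega1_le.
Proof. by move=> a b /wo_le_anti /val_inj. Qed.

Lemma omega1_le_trans : transitive omega1_le.
Proof. by move=> b a c; exact: wo_le_trans. Qed.

Lemma omega1_le_total : total omega1_le.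
Proof. by move=> a b; exact: wo_le_total. Qed.

Fact omega1_display : Order.disp_t. Proof. exact: (Order.Disp tt tt). Qed.

HB.instance Definition _ := Order.isOrder.Build omega1_display omega1
  (fun _ _ => erefl) (fun _ _ => erefl) (fun _ _ => erefl)
  omega1_le_anti omega1_le_trans omega1_le_total.

Lemma omega1_least (A : set omega1) :
  A !=set0 -> exists2 a, A a & forall b, A b -> a <= b.
Proof.
move=> [x Ax].
have [|_ [a Aa <-] lba] := @wo_le_min (val @` A); first by exists (val x), x.
by exists a => // b Ab; apply: lba; exists b.
Qed.

Lemma omega1_countable (a : omega1) : countable [set b | b <= a].
Proof.
have /countable_injP[g ginj] : countable [set b | wo_le b (val a)].
  by have := valP a; rewrite inE.
apply/countable_injP; exists (g \o val) => x y; rewrite !inE => xa ya gxy.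
by apply/val_inj/ginj; rewrite ?inE.
Qed.

Lemma omega1_uncountable : ~ countable [set: omega1].
Proof.
pose W := [set a : set nat | countable [set b | wo_le b a]].
move=> /countable_injP[g ginj].
have cW : countable W.
  apply/countable_injP.
  exists (fun a => if pselect (a \in W) is left aW then g (SigSub aW) else 0%N).
  move=> a b aW bW; case: pselect => // aW'; case: pselect => // bW'.
  by move=> /(ginj _ _ (in_setT _) (in_setT _)) /(congr1 val).
have [|a aNW mina] := @wo_le_min (~` W).
  apply/set0P/negP => /eqP W0; have WT : W = setT by rewrite -[W]setCK W0 setC0.
  move: cW; rewrite WT => /countable_injP[h hinj].
  pose D := [set n | exists2 A, h A = n & ~ A n].
  have : ~ D (h D) by move=> /[dup] DhD [A /hinj -> //]; rewrite inE.
  by move=> nD; apply: (nD); exists D.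
apply: aNW; rewrite /W /=.
pose F (c : bool) : set (set nat) := if c then [set b | b = a] else W.
have cF : countable (\bigcup_(c in [set: bool]) F c).
  apply: bigcup_countable => // -[] _ //=.
  exact: countable1.
apply: sub_countable cF; apply: subset_card_le => b /= ba.
have [bW|bNW] := pselect (W b); first by exists false.
by exists true => //; apply/wo_le_anti/andP; split=> //; exact: mina.
Qed.

Definition is_zero (a : omega1) : Prop := forall b, a <= b.

Definition is_succ (b a : omega1) : Prop := b < a /\ forall c, c < a -> c <= b.

Definition is_one (a : omega1) : Prop := exists2 z, is_zero z & is_succ z a.

Definition is_limit (a : omega1) : Prop :=
  ~ is_zero a /\ ~ exists b, is_succ b a.

Definition diam {R : realType} {T : metricType R} (A : set T) : \bar R :=
  ereal_sup [set (mdist p q)%:E | p in A & q in A].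

(* Sequences are indexed by nat: D i and O i stand for y_(i+1) and O(y_(i+1)). *)
Definition separated_sequence {R : realType} {Y : metricType R}
    (y : Y) (D : nat -> Y) (O : nat -> set Y) : Prop :=
  [/\ injective D,
      D @ \oo --> y,
      trivIset setT O &
      forall i, [/\ nbhs (D i) (O i),
                    (diam (O i) < (i.+1%:R^-1)%:E)%E &
                    ~ O i y]].

(* [canonical_compact a y S] is the type of the constructions of S as a        *)
(* compactum S_a(y): an inhabitant records all the choices made, on which the  *)
(* associated sub-compacta depend.                                             *)
Inductive canonical_compact {R : realType} {Y : metricType R} :
    omega1 -> Y -> set Y -> Type :=
| canonical_one (a : omega1) (y : Y) (D : nat -> Y) (O : nat -> set Y) :
    is_one a ->
    separated_sequence y D O ->
    canonical_compact a y ([set y] `|` range D)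
| canonical_succ (a b : omega1) (y : Y) (D : nat -> Y) (O S : nat -> set Y) :
    is_succ b a -> ~ is_zero b ->
    separated_sequence y D O ->
    (forall i, canonical_compact b (D i) (S i)) ->
    (forall i, S i `<=` O i) ->
    canonical_compact a y ([set y] `|` \bigcup_i S i)
| canonical_limit (a : omega1) (b : nat -> omega1)
    (y : Y) (D : nat -> Y) (O S : nat -> set Y) :
    is_limit a -> increasing_seq b -> (forall i, ~ is_zero (b i) /\ b i < a) ->
    separated_sequence y D O ->
    (forall i, canonical_compact (b i) (D i) (S i)) ->
    (forall i, S i `<=` O i) ->
    canonical_compact a y ([set y] `|` \bigcup_i S i).

Fixpoint associated {R : realType} {Y : metricType R} {a : omega1} {y : Y}
    {S : set Y} (c : canonical_compact a y S) (A : set Y) {struct c} : Prop :=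
  match c with
  | @canonical_one _ _ _ y D _ _ _ =>
      exists2 k : nat -> nat, increasing_seq k &
        A = [set y] `|` range (D \o k)
  | @canonical_succ _ _ _ _ y _ _ _ _ _ _ cS _ =>
      exists (k : nat -> nat) (T : nat -> set Y),
        [/\ increasing_seq k,
            forall j, associated (cS (k j)) (T j) &
            A = [set y] `|` \bigcup_j T j]
  | @canonical_limit _ _ _ _ y _ _ _ _ _ _ _ cS _ =>
      exists (k : nat -> nat) (T : nat -> set Y),
        [/\ increasing_seq k,
            forall j, associated (cS (k j)) (T j) &
            A = [set y] `|` \bigcup_j T j]
  end.

Definition restricts_to_homeomorphism {X Y : topologicalType} (f : X -> Y)
    (K : set X) (A : set Y) : Prop :=
  [/\ set_bij K A f,
      {within K, continuous f} &
      exists2 g : Y -> X, {within A, continuous g} & {in K, cancel f g}].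

Definition H_alpha_covering {R : realType} {X Y : metricType R}
    (a : omega1) (f : X -> Y) : Prop :=
  forall (y : Y) (S : set Y) (c : canonical_compact a y S),
    exists (A : set Y) (K : set X),
      associated c A /\ restricts_to_homeomorphism f K A.

Definition H_covering {R : realType} {X Y : metricType R} (f : X -> Y) : Prop :=
  forall a : omega1, ~ is_zero a -> H_alpha_covering a f.

Definition stable {R : realType} {X Y : metricType R} (f : X -> Y) : Prop :=
  exists eta : Y -> set (set X),
    [/\ forall y, eta y !=set0,
        forall y U, eta y U -> U `&` f @^-1` [set y] !=set0 &
        forall y U V, eta y U -> open V -> U `&` f @^-1` [set y] `<=` V ->
          \forall w \near y, eta w V].

(* Main.v *)
Require Import Defs.
From mathcomp Require Import all_boot all_order all_algebra.
From mathcomp Require Import all_classical all_reals all_analysis.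
From mathcomp Require Import lra.

(** A lift of a subset [A] of [Y] is a set [K] that [f] maps homeomorphically
    onto [A].

    A stable map is [H]-covering.  Fix a family [eta] as in the definition of
    stability.  By induction on the construction of a canonical compactum at
    [y], each [U] in [eta y] contains a point [x] over [y] such that every
    neighborhood of [x] contains a lift of some associated sub-compactum
    ([stable_small_lifts]).  Asking for arbitrarily small lifts near a single
    point is what makes the induction work.  In the inductive step, suppose
    that every [x] in [U] over [y] has a neighborhood containing lifts of only
    finitely many of the blocks [S i].  Since the blocks are closed and miss
    [y], that neighborhood can be shrunk until it misses the fibres of these
    finitely many blocks, and then it contains no lift at all.  The union [V] of
    the shrunken neighborhoods is open and contains the part of [U] over [y], so
    it belongs to [eta (D i)] for large [i]; the induction hypothesis at [D i]
    gives small lifts near a point of [V], hence inside one of the shrunken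
    neighborhoods, which is absurd ([stable_fan]).  So some [x] has lifts of
    infinitely many blocks in each of its neighborhoods; choosing them ever
    closer to [x] and adding [x] gives a lift of a fan ([homeo_lift_glue]).

    An [H]-covering map is stable.  Call [U] bad at [y] when every neighborhood
    of [y] contains a canonical compactum at [y] none of whose associated
    sub-compacta has a lift meeting [U] over [y], and let [eta y] consist of the
    sets that are not bad at [y].  The covering property says that the whole
    space is never bad.  The point is the stability condition ([bad_open]): if
    [V] is open, contains the part of [U] over [y], and is bad at points
    arbitrarily near [y], then [U] is bad at [y].  Indeed a sequence of such
    points carries bad canonical compacta in disjoint neighborhoods; a sequence
    of countable ordinals has a constant or an increasing subsequence
    ([omega1_subseq]), so after thinning, these compacta are the blocks of a
    canonical compactum at [y] of successor or of limit rank.  A lift of one of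
    its sub-compacta through a point of [U] over [y] enters the open set [V],
    and so contains a lift of a sub-compactum of some block, meeting [V] over
    its base point: a contradiction ([bad_fan]).  No rank has to be controlled,
    so a single definition of badness replaces a recursion over the ordinals. *)

Set Implicit Arguments.
Unset Strict Implicit.
Unset Printing Implicit Defensive.

Import Order.TTheory GRing.Theory Num.Theory.

Local Open Scope classical_set_scope.

(** * Homeomorphic lifts *)

(** The second clause is continuity of the inverse of [f] on [A].  In a
    Hausdorff space it already forces [f] to be injective on [K], so that
    injectivity never has to be carried along. *)
Definition homeo_lift {X Y : topologicalType} (f : X -> Y) (K : set X)
    (A : set Y) : Prop :=
  f @` K = A /\
  forall p W, K p -> nbhs p W ->
    \forall w \near f p, K `&` f @^-1` [set w] `<=` W.

(** If [f p = f q], every neighborhood of [p] contains [q], because the local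
    clause at [p] applies to the value [f p] itself. *)
Lemma homeo_lift_inj {X Y : topologicalType} (f : X -> Y) K A :
  hausdorff_space X -> homeo_lift f K A -> set_inj K f.
Proof.
move=> hX [_ loc] p q; rewrite !inE => Kp Kq fpq.
apply: hX => P Q nP nQ; exists q; split; last exact: nbhs_singleton nQ.
by have /nbhs_singleton := loc p P Kp nP; apply; split.
Qed.

(** The nonempty [K] provides a default value for the inverse of [f] outside
    its image. *)
Lemma homeo_liftP {X Y : topologicalType} (f : X -> Y) K A :
  hausdorff_space X -> continuous f -> K !=set0 ->
  restricts_to_homeomorphism f K A <-> homeo_lift f K A.
Proof.
move=> hX cf [x0 _]; split.
  move=> [[fKA fI fS] _ [g /subspace_continuousP gc gf]]; split.
    by apply/seteqP; split=> [_ [p Kp <-]|//]; exact: fKA.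
  move=> p W Kp nW; have gW : nbhs (g (f p)) W by rewrite gf ?inE.
  have : \forall w \near f p, A w -> W (g w) := gc _ (fKA _ Kp) _ gW.
  apply: filterS => w wW q [Kq /= qw].
  by rewrite -(gf q) ?inE // qw; apply: wW; rewrite -qw; exact: fKA.
move=> KA; have fI := homeo_lift_inj hX KA; case: KA => <- loc.
split; first by split=> // p Kp; exists p.
  by apply/continuous_subspaceT.
pose g w := if pselect (exists2 q, K q & f q = w) is left e
            then sval (cid2 e) else x0.
have gf : {in K, cancel f g}.
  move=> q; rewrite inE => Kq; rewrite /g; case: pselect => [e|]; last first.
    by case; exists q.
  by case: cid2 => /= q' Kq' /fI; apply; rewrite inE.
exists g => //; apply/subspace_continuousP => _ [p Kp <-] W.
rewrite /from_subspace /= gf ?inE // => nW.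
suff : \forall w \near f p, (f @` K) w -> W (g w) by [].
have := loc p W Kp nW; apply: filterS => w wW [q Kq qw]; apply: wW.
by rewrite -qw gf ?inE //; split.
Qed.

Lemma homeo_lift_sub {X Y : topologicalType} (f : X -> Y) K A T :
  homeo_lift f K A -> T `<=` A -> homeo_lift f (K `&` f @^-1` T) T.
Proof.
move=> [<- loc] TA; split.
  apply/seteqP; split=> [_ [p [_ Tp] <-]//|w Tw].
  by have [p Kp pw] := TA _ Tw; exists p => //; split=> //=; rewrite pw.
move=> p W [Kp _] /(loc _ _ Kp); apply: filterS => w KW q [[Kq _] qw].
by apply: KW; split.
Qed.

(** * Increasing sequences of indices *)

Lemma leq_increasing_seq (k : nat -> nat) : increasing_seq k ->
  forall n, (n <= k n)%N.
Proof.
move=> kI; elim=> // n IHn; apply: leq_ltn_trans IHn _.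
by have := (increasing_seqP k).2 kI n; rewrite ltEnat.
Qed.

Lemma cvg_subseq (T : topologicalType) (u : nat -> T) (k : nat -> nat)
    (l : T) :
  increasing_seq k -> u @ \oo --> l -> u \o k @ \oo --> l.
Proof.
move=> kI; apply: cvg_comp; apply/cvgnyPge => N; exists N => // n /= Nn.
exact: leq_trans Nn (leq_increasing_seq kI n).
Qed.

Lemma increasing_choice (Q : nat -> nat -> Prop) :
  (forall j n, exists2 i, (n <= i)%N & Q j i) ->
  exists2 k : nat -> nat, increasing_seq k & forall j, Q j (k j).
Proof.
move=> QP; have /choice[g gP] : forall p : nat * nat,
    exists i, (p.2 <= i)%N /\ Q p.1 i.
  by move=> [j n]; have [i ni Qi] := QP j n; exists i.
pose k := fix k j := if j is j'.+1 then g (j, (k j').+1) else g (0%N, 0%N).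
exists k; last by case=> [|j]; [exact: (gP (_, _)).2|exact: (gP (_, _)).2].
by apply/increasing_seqP => j; rewrite ltEnat /=; exact: (gP (_, _)).1.
Qed.

(** * Separated sequences *)

Section Separated.
Context {R : realType} {Y : metricType R}.
Implicit Types (y : Y) (D : nat -> Y) (O S : nat -> set Y).

Lemma metric_closed1 y : closed [set y].
Proof.
exact/accessible_closed_set1/hausdorff_accessible/metric_hausdorff.
Qed.

Lemma mem_separated y D O i : separated_sequence y D O -> O i (D i).
Proof. by move=> [_ _ _ /(_ i) [/nbhs_singleton]]. Qed.

Lemma mdist_lt_diam (A : set Y) (e : R) p q :
  (diam A < e%:E)%E -> A p -> A q -> (mdist p q < e)%R.
Proof.
move=> dA Ap Aq; rewrite -lte_fin; apply: le_lt_trans dA.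
by apply: ereal_sup_ubound; exists p => //; exists q.
Qed.

Lemma separated_cvg y D O N : separated_sequence y D O -> nbhs y N ->
  \forall i \near \oo, O i `<=` N.
Proof.
move=> sD; have [_ Dy _ DO] := sD.
rewrite -metricType_numDomainType.filter_from_mdist_nbhs => -[e /= e0 eN].
have e20 : (0 < e / 2)%R by rewrite divr_gt0.
have yD := metricType_numDomainType.cvgr_dist_lt Dy e20.
near=> i => p Op; apply: eN => /=.
apply: le_lt_trans (metric_triangle _ (D i) _) _.
rewrite [ltRHS]splitr ltrD //; first by near: i; exact: yD.
apply: (@lt_trans _ _ i.+1%:R^-1)%R; last first.
  by near: i; exact: (near_infty_natSinv_lt (PosNum e20)).
by have [_ dO _] := DO i; exact: mdist_lt_diam dO (mem_separated i sD) Op.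
Unshelve. all: by end_near. Qed.

(** The blocks accumulate only at [y]: near any other point, a union of blocks
    is a finite union of closed sets. *)
Lemma separated_closed y D O S (P : set nat) : separated_sequence y D O ->
  (forall i, S i `<=` O i) -> (forall i, closed (S i)) ->
  closed ([set y] `|` \bigcup_(i in P) S i).
Proof.
move=> sD SO Sc p clp; apply: contrapT => np.
apply: (np); left; apply: metric_hausdorff => M N nM nN.
have [n _ nO] := separated_cvg sD nN.
pose C := \bigcup_(i in P `&` `I_n) S i.
have cC : closed C.
  by apply: closed_bigcup => [|i _]; [exact/finite_setIr/finite_II|exact: Sc].
have nC : nbhs p (M `&` ~` C).
  apply: filterI nM _; apply: open_nbhs_nbhs; split; first exact: closed_openC.
  by move=> [i [Pi _] Sp]; apply: np; right; exists i.
have [q [[->|[i Pi Sq]] [Mq nCq]]] := clp _ nC.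
  by exists y; split=> //; exact: nbhs_singleton.
exists q; split=> //; apply: (nO i); last exact: SO.
by rewrite /= leqNgt; apply/negP => lt_in; apply: nCq; exists i.
Qed.

Lemma separated_subseq y D O (k : nat -> nat) : increasing_seq k ->
  separated_sequence y D O -> separated_sequence y (D \o k) (O \o k).
Proof.
move=> kI [DI Dy Ot DO]; have kinj := increasing_seq_injective kI.
split.
- exact: inj_comp DI kinj.
- exact: cvg_subseq Dy.
- by move=> i j _ _ /Ot h; exact/kinj/h.
- move=> i; have [nO dO Oy] := DO (k i); split=> //.
  apply: lt_le_trans dO _; rewrite lee_fin lef_pV2 ?posrE ?ltr0Sn //.
  by rewrite ler_nat ltnS leq_increasing_seq.
Qed.

End Separated.

(** The distances [d n] of the points to [y] at least halve at each step, and
    the ball around the [n]-th point has radius at most [d n / 4].  So this ball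
    lies in the shell of points at distance between [3/4 d n] and [5/4 d n] from
    [y], and these shells are disjoint since [5/8 < 3/4]. *)
Lemma separated_in {R : realType} {Y : metricType R} (E : set Y) (y : Y) N :
  limit_point E y -> nbhs y N ->
  exists D O, separated_sequence y D O /\ forall i, E (D i) /\ O i `<=` N.
Proof.
move=> Ey; rewrite -metricType_numDomainType.filter_from_mdist_nbhs.
move=> [e /= e0 eN].
have /choice[g gP] : forall t : R, exists w : Y,
    (0 < t)%R -> [/\ E w, (0 < mdist y w)%R & (mdist y w < t)%R].
  move=> t; have [t0|] := pselect (0 < t)%R; last by exists y.
  have [|w [wy Ew ytw]] := Ey (ball y t); first exact: nbhsx_ballx.
  rewrite ballEmdist in ytw; exists w => _; split=> //.
  by rewrite mdist_gt0 eq_sym.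
pose D := fix D n := if n is n'.+1
  then g (Num.min (mdist y (D n') / 2) n.+1%:R^-1)%R
  else g (Num.min (e / 2) 1)%R.
have DP n : E (D n) /\ (0 < mdist y (D n))%R.
  elim: n => [|n [_ d0]].
    by have [] := gP (Num.min (e / 2) 1)%R; rewrite ?lt_min ?divr_gt0 //=.
  have [] := gP (Num.min (mdist y (D n) / 2) n.+2%:R^-1)%R => //.
  by rewrite lt_min divr_gt0 //= invr_gt0.
pose d n := mdist y (D n); have d0 n : (0 < d n)%R by have [] := DP n.
have dS n : (d n.+1 < d n / 2)%R /\ (d n.+1 < n.+2%:R^-1)%R.
  have [] := gP (Num.min (d n / 2) n.+2%:R^-1)%R.
    by rewrite lt_min divr_gt0 //= invr_gt0.
  by rewrite lt_min => _ _ /andP.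
have d00 : (d 0%N < e / 2)%R /\ (d 0%N < 1)%R.
  have [] := gP (Num.min (e / 2) 1)%R; first by rewrite lt_min divr_gt0 /=.
  by rewrite lt_min => _ _ /andP.
pose O n := ball (D n) (Num.min (d n / 4) (4 * n.+1%:R)^-1)%R.
have dmono m n : (m < n)%N -> (d n < d m / 2)%R.
  elim: n => // n IH; rewrite ltnS leq_eqVlt => /orP[/eqP->|/IH h].
    by have [] := dS n.
  have [h' _] := dS n; have := d0 n; lra.
have Oe n p : O n p -> [/\ (d n * 3 / 4 < mdist y p)%R,
    (mdist y p < d n * 5 / 4)%R & (mdist (D n) p < (4 * n.+1%:R)^-1)%R].
  rewrite /O ballEmdist /= lt_min => /andP[h1 h2].
  have t1 := metric_triangle y (D n) p; have t2 := metric_triangle y p (D n).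
  rewrite (metric_sym p) in t2; rewrite -/(d n) in t1 t2.
  by split=> //; lra.
exists D, O; split; last first.
  move=> i; split; first by have [] := DP i.
  move=> p /Oe [_ h _]; apply: eN => /=.
  have [h0 _] := d00.
  have : (d i <= d 0%N)%R.
    by case: i h => // i _; have := dmono 0%N i.+1 isT; have := d0 0%N; lra.
  lra.
have dinj m n : d m = d n -> m = n.
  move=> dmn; case: (ltngtP m n) => // /dmono h; exfalso;
    by have := d0 m; have := d0 n; lra.
split.
- by move=> m n Dmn; apply: dinj; rewrite /d Dmn.
- have dlt n : (d n < n.+1%:R^-1)%R.
    by case: n => [|n]; [rewrite invr1; have [] := d00|have [] := dS n].
  apply/metricType_numDomainType.cvgrPdist_lt => t t0.
  near=> n; apply: lt_trans (dlt n) _.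
  by near: n; exact: (near_infty_natSinv_lt (PosNum t0)).
- move=> m n _ _ [p [/Oe[m1 m2 _] /Oe[n1 n2 _]]].
  case: (ltngtP m n) => // /dmono h; exfalso;
    by have := d0 m; have := d0 n; lra.
- move=> i; split.
  + by apply: nbhsx_ballx; rewrite lt_min divr_gt0 // invr_gt0 mulr_gt0.
  + apply: (@le_lt_trans _ _ (2^-1 * i.+1%:R^-1)%:E).
      apply: ge_ereal_sup => _ [p /Oe[_ _ h1] [q /Oe[_ _ h2] <-]].
      rewrite lee_fin; have := metric_triangle p (D i) q.
      rewrite (metric_sym p (D i)); rewrite invfM in h1 h2.
      by move: (i.+1%:R^-1)%R h1 h2 => u h1 h2; lra.
    by rewrite lte_fin gtr_pMl ?invr_gt0 // invf_lt1 // ltr1n.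
  + by move=> /Oe[+ _ _]; rewrite mdistxx; have := d0 i; lra.
Unshelve. all: by end_near. Qed.

(** * Canonical compacta *)

Section Canonical.
Context {R : realType} {Y : metricType R}.

Lemma canonical_base a (y : Y) S : canonical_compact a y S -> S y.
Proof. by case=> *; left. Qed.

Lemma canonical_closed a (y : Y) S : canonical_compact a y S -> closed S.
Proof.
elim=> {a y S} [a y D O _ sD|a b y D O S _ _ sD _ Sc SO|
    a b y D O S _ _ _ sD _ Sc SO].
- rewrite -(bigcup_imset1 setT D).
  apply: (separated_closed (S := fun i => [set D i]) sD) => [i _ ->|i].
    exact: mem_separated sD.
  exact: metric_closed1.
- exact: separated_closed sD SO Sc.
- exact: separated_closed sD SO Sc.
Qed.

Lemma canonical_neq0 a (y : Y) S : canonical_compact a y S -> ~ is_zero a.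
Proof.
case=> {a y S} [a _ _ _ [z _ [za _]] _ a0|a b _ _ _ _ [ba _] _ _ _ _ a0|].
- by have := a0 z; rewrite leNgt za.
- by have := a0 b; rewrite leNgt ba.
- by move=> a b y D O S [].
Qed.

Lemma associated_base a (y : Y) S (c : canonical_compact a y S) A :
  associated c A -> A y.
Proof.
by case: c => /= [? ? ? ? ? ? [k _ ->]|? ? ? ? ? ? ? ? ? ? ? [k [T [_ _ ->]]]
  |? ? ? ? ? ? ? ? ? ? ? ? [k [T [_ _ ->]]]]; left.
Qed.

Lemma associated_sub a (y : Y) S (c : canonical_compact a y S) A :
  associated c A -> A `<=` S.
Proof.
elim: c A => {a y S} /= [a y D O _ _ A [k _ ->]|
    a b y D O S _ _ _ c IH _ A [k [T [_ cT ->]]]|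
    a b y D O S _ _ _ _ c IH _ A [k [T [_ cT ->]]]].
- by apply: setUS => _ [j _ <-]; exists (k j).
- by apply: setUS => p [j _ Tp]; exists (k j) => //; exact: IH (cT j) _ Tp.
- by apply: setUS => p [j _ Tp]; exists (k j) => //; exact: IH (cT j) _ Tp.
Qed.

End Canonical.

(** * Gluing lifts *)

(** Near [y] the inverse is continuous because the [K i] shrink to [x], while
    the finitely many blocks whose lifts may be far from [x] are closed and miss
    [y].  Near a point of a block it is continuous because the other blocks
    together with [y] form a closed set missing that block. *)
Lemma homeo_lift_glue {R : realType} {X Y : metricType R} (f : X -> Y)
    (y : Y) (D : nat -> Y) (O S T : nat -> set Y) (x : X) (K : nat -> set X) :
  separated_sequence y D O -> (forall i, S i `<=` O i) ->
  (forall i, closed (S i)) -> (forall i, T i `<=` S i) -> f x = y ->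
  (forall i, homeo_lift f (K i) (T i)) ->
  (forall i, K i `<=` ball x i.+1%:R^-1) ->
  homeo_lift f ([set x] `|` \bigcup_i K i) ([set y] `|` \bigcup_i T i).
Proof.
move=> sD SO Sc TS fx KT Kx.
have fK i p : K i p -> T i (f p) by move=> Kp; rewrite -(KT i).1; exists p.
have Sy i : ~ S i y by move=> /SO; case: sD => _ _ _ /(_ i) [].
split.
  apply/seteqP; split=> [_ [p [->|[i _ Kp]] <-]|w [->|[i _]]].
  - by left.
  - by right; exists i => //; exact: fK.
  - by exists x => //; left.
  - by rewrite -(KT i).1 => -[p Kp <-]; exists p => //; right; exists i.
move=> p W [->|[i _ Kp]] nW.
  have [n _ nK] : \forall i \near \oo, ball x i.+1%:R^-1 `<=` W.
    have /nbhs_ballP [e /= e0 eW] := nW.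
    near=> i; apply: subset_trans eW; apply: le_ball; apply: ltW.
    by near: i; exact: (near_infty_natSinv_lt (PosNum e0)).
  have : \forall w \near y, ~ (\bigcup_(i in `I_n) S i) w.
    apply: open_nbhs_nbhs; split; last by move=> [i _ /Sy].
    by apply/closed_openC/closed_bigcup => //; exact: finite_II.
  rewrite fx; apply: filterS => w nSw q [[->|[i _ Kq]] qw].
    exact: nbhs_singleton.
  apply: (nK i); last exact: Kx.
  rewrite /= leqNgt; apply/negP => lt_in; apply: nSw; exists i => //.
  by rewrite -qw; apply/TS/fK.
have SD j q : S j q -> S i q -> i = j.
  by move=> /SO Oj /SO Oi; case: sD => _ _ Ot _; apply: Ot => //; exists q.
have : \forall w \near f p, ~ ([set y] `|` \bigcup_(j in [set~ i]) S j) w.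
  apply: open_nbhs_nbhs; split.
    by apply/closed_openC; exact: separated_closed sD SO Sc.
  have Sp := TS _ _ (fK _ _ Kp).
  move=> [py|[j ji Sj]]; first by apply: (Sy i); rewrite -py.
  by apply: ji; exact/esym/(SD j (f p)).
apply: filterS2 ((KT i).2 p W Kp nW) => w KW nSw q [[->|[j _ Kq]] /= qw].
  by case: nSw; left; rewrite -qw.
have [ij|ij] := eqVneq i j; first by apply: KW; split; rewrite ?ij.
case: nSw; right; exists j; first by move=> ji; rewrite ji eqxx in ij.
by rewrite -qw; apply/TS/fK.
Unshelve. all: by end_near. Qed.

(** The sub-compacta associated with a canonical compactum of successor or limit
    rank, when [P i] is the family of those associated with its [i]-th block. *)
Definition fan {Y : Type} (y : Y) (P : nat -> set (set Y)) : set (set Y) :=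
  [set A | exists (k : nat -> nat) (T : nat -> set Y),
    [/\ increasing_seq k, forall j, P (k j) (T j) &
        A = [set y] `|` \bigcup_j T j]].

Definition small_lifts {X Y : topologicalType} (f : X -> Y) (x : X)
    (P : set (set Y)) : Prop :=
  forall W, nbhs x W ->
    exists A K, [/\ P A, K `<=` W & homeo_lift f K A].

Lemma small_lifts_fan {R : realType} {X Y : metricType R} (f : X -> Y)
    (y : Y) (D : nat -> Y) (O S : nat -> set Y) (P : nat -> set (set Y))
    (x : X) :
  separated_sequence y D O -> (forall i, S i `<=` O i) ->
  (forall i, closed (S i)) -> (forall i A, P i A -> A `<=` S i) -> f x = y ->
  (forall W n, nbhs x W -> exists2 i, (n <= i)%N &
    exists A K, [/\ P i A, K `<=` W & homeo_lift f K A]) ->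
  small_lifts f x (fan y P).
Proof.
move=> sD SO Sc PS fx xP W nW.
have [|k kI /= /choice[T /choice[K TK]]] := @increasing_choice (fun j i =>
    exists A K, [/\ P i A, K `<=` W `&` ball x j.+1%:R^-1 & homeo_lift f K A]).
  move=> j n; apply: xP; apply: filterI nW _.
  by apply: nbhsx_ballx; rewrite invr_gt0.
exists ([set y] `|` \bigcup_j T j), ([set x] `|` \bigcup_j K j); split.
- by exists k, T; split=> // j; have [] := TK j.
- move=> q [->|[j _ Kq]]; first exact: nbhs_singleton.
  by have [_ KW _] := TK j; have [] := KW q Kq.
- apply: (homeo_lift_glue (separated_subseq kI sD) (S := S \o k)).
  + by move=> i; exact: SO.
  + by move=> i; exact: Sc.
  + by move=> i; have [/PS] := TK i.
  + by [].
  + by move=> i; have [] := TK i.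
  + by move=> i q Kq; have [_ KW _] := TK i; have [] := KW q Kq.
Qed.

(** * Stable maps are H-covering *)

Section StableToCovering.
Context {R : realType} {X Y : metricType R} (f : X -> Y).
Hypothesis cf : continuous f.
Variable eta : Y -> set (set X).
Hypothesis eta_meets :
  forall y U, eta y U -> U `&` f @^-1` [set y] !=set0.
Hypothesis eta_open : forall y U V, eta y U -> open V ->
  U `&` f @^-1` [set y] `<=` V -> \forall w \near y, eta w V.

(** If no point of [U] over [y] were a limit of lifts of infinitely many
    blocks, the neighborhoods witnessing this could be shrunk to contain no lift
    at all; their union [V] would still be in [eta (D n)] for some [n]. *)
Lemma stable_fan (y : Y) (D : nat -> Y) (O S : nat -> set Y)
    (P : nat -> set (set Y)) (U : set X) :
  separated_sequence y D O -> (forall i, S i `<=` O i) ->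
  (forall i, closed (S i)) -> (forall i, S i (D i)) ->
  (forall i A, P i A -> A `<=` S i) ->
  (forall i V, eta (D i) V ->
    exists x, [/\ V x, f x = D i & small_lifts f x (P i)]) ->
  eta y U -> exists x, [/\ U x, f x = y & small_lifts f x (fan y P)].
Proof.
move=> sD SO Sc SD PS IH etaU; apply: contrapT => noX.
have /choice[Wn WnP] : forall x, exists Wn : set X * nat,
    U x -> f x = y -> nbhs x Wn.1 /\ forall i, (Wn.2 <= i)%N ->
    ~ exists A K, [/\ P i A, K `<=` Wn.1 & homeo_lift f K A].
  move=> x; apply: contrapT => xN; apply: noX; exists x.
  have Ux : U x by apply: contrapT => nUx; apply: xN; exists (setT, 0%N).
  have fx : f x = y by apply: contrapT => nfx; apply: xN; exists (setT, 0%N).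
  split=> //; apply: (small_lifts_fan sD SO Sc PS fx) => // W n nW.
  apply: contrapT => Wi; apply: xN; exists (W, n) => _ _; split=> //= i ni AK.
  by apply: Wi; exists i.
(* Over the complement of [C n] only blocks of index at least [n] remain. *)
pose C n := \bigcup_(i in `I_n) S i.
pose G x := (Wn x).1^° `&` f @^-1` (~` C (Wn x).2).
pose V := \bigcup_(x in U `&` f @^-1` [set y]) G x.
have oV : open V.
  apply: bigcup_open => x _; apply: openI; first exact: open_interior.
  apply: open_comp; first by move=> z _; exact: cf.
  by apply/closed_openC/closed_bigcup => //; exact: finite_II.
have UV : U `&` f @^-1` [set y] `<=` V.
  move=> x [Ux fx]; exists x => //; split; first by have [] := WnP x Ux fx.
  rewrite /= fx => -[i _ /SO]; by case: sD => _ _ _ /(_ i) [].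
have [_ Dy _ _] := sD.
have [n _ etaV] : \forall i \near \oo, eta (D i) V.
  exact: Dy _ (eta_open etaU oV UV).
have [x' [[x [Ux fx] [Gx nCx]] fx' lx']] := IH n V (etaV n (leqnn n)).
have [_ /(_ n)] := WnP x Ux fx; apply.
  rewrite leqNgt; apply/negP => nlt; apply: nCx; exists n => //.
  by rewrite fx'.
exact: lx'.
Qed.

Lemma stable_small_lifts a (y : Y) S (c : canonical_compact a y S) U :
  eta y U -> exists x, [/\ U x, f x = y & small_lifts f x (associated c)].
Proof.
elim: c U => {a y S} [a y D O a1 sD U etaU|
    a b y D O S ba b0 sD c IH SO U|a b y D O S alim bI ba sD c IH SO U].
(* Rank one is a fan whose blocks are single points. *)
- have [||||i V /eta_meets[x [Vx fx]]|x [Ux fx lx]] := stable_fan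
      (S := fun i => [set D i]) (P := fun i => [set [set D i]])
      sD _ _ _ _ _ etaU.
  + by move=> i _ ->; exact: mem_separated sD.
  + by move=> i; exact: metric_closed1.
  + by [].
  + by move=> i A ->.
  + exists x; split=> // W nW; exists [set D i], [set x]; split=> //.
      by move=> _ ->; exact: nbhs_singleton.
    split; first by rewrite image_set1 fx.
    move=> p V' -> nV'; near=> w => _ [-> _]; exact: nbhs_singleton.
  + exists x; split=> // W /lx[A [K [[k [T [kI TD ->]]] KW lK]]].
    exists ([set y] `|` range (D \o k)), K; split=> //; first by exists k.
    have <- : \bigcup_j T j = range (D \o k); last by [].
    by rewrite -(bigcup_imset1 setT); apply: eq_bigcupr => j _; exact: TD.
- exact: (stable_fan sD SO (fun i => canonical_closed (c i))
    (fun i => canonical_base (c i))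
    (fun i A => @associated_sub _ _ _ _ _ (c i) A) IH).
- exact: (stable_fan sD SO (fun i => canonical_closed (c i))
    (fun i => canonical_base (c i))
    (fun i A => @associated_sub _ _ _ _ _ (c i) A) IH).
Unshelve. all: by end_near. Qed.

End StableToCovering.

Lemma stable_H_covering {R : realType} {X Y : metricType R} (f : X -> Y) :
  continuous f -> stable f -> H_covering f.
Proof.
move=> cf [eta [eta0 etam etao]] a _ y S c.
have [U etaU] := eta0 y.
have [x [_ fx /(_ setT filterT)]] := stable_small_lifts cf etam etao c etaU.
move=> [A [K [cA _ lK]]]; exists A, K; split=> //; apply/homeo_liftP => //.
  exact: metric_hausdorff.
have [KA _] := lK; have := associated_base cA; rewrite -KA => -[p Kp _].
by exists p.
Qed.

(** * Countable ordinals *)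

Section Omega1.
Local Open Scope order_scope.

Lemma omega1_bound (r : nat -> omega1) : exists a, forall i, r i < a.
Proof.
apply: contrapT => nob; apply: omega1_uncountable.
apply: sub_countable (bigcup_countable (I := nat) (D := setT)
  (F := fun i => [set b | b <= r i]) _ _) => //; last first.
  by move=> i _; exact: omega1_countable.
apply: subset_card_le => a _; apply: contrapT => na; apply: nob; exists a => i.
by rewrite ltNge; apply/negP => ai; apply: na; exists i.
Qed.

Lemma omega1_succ (b : omega1) : exists a, is_succ b a.
Proof.
have [a0 ba0] := omega1_bound (fun=> b).
have [|a ba amin] := @omega1_least [set a | b < a].
  by exists a0; exact: (ba0 0%N).
exists a; split=> // c ca; rewrite leNgt; apply/negP => bc.
by have := amin c bc; rewrite leNgt ca.
Qed.

Lemma omega1_one : exists a, is_one a.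
Proof.
have [z0 _] : [set: omega1] !=set0.
  apply: contrapT => n0; apply: omega1_uncountable.
  by have -> : [set: omega1] = set0 by apply/eqP/negPn/negP => /set0P.
have [|z _ zmin] := @omega1_least setT; first by exists z0.
have [a za] := omega1_succ z.
by exists a, z => // b; exact: zmin.
Qed.

(** The least strict upper bound of an increasing sequence is a limit: any
    predecessor would be at most some [r i], hence below [r i.+1]. *)
Lemma omega1_limit (r : nat -> omega1) : increasing_seq r ->
  exists2 a, is_limit a & forall i, r i < a.
Proof.
move=> rI; have [a0 ra0] := omega1_bound r.
have [|a ra amin] := @omega1_least [set a | forall i, r i < a].
  by exists a0.
exists a => //; split=> [az|[c [ca cmax]]].
  by have := az (r 0%N); rewrite leNgt ra.
have [i ci] : exists i, c <= r i.
  apply: contrapT => nc; have : a <= c; last by rewrite leNgt ca.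
  apply: amin => i; rewrite ltNge; apply/negP => ci.
  by apply: nc; exists i.
have := (increasing_seqP r).2 rI i.
by rewrite ltNge (le_trans (cmax _ (ra i.+1)) ci).
Qed.

(** Let [a] be least such that infinitely many terms are at most [a].  Either
    infinitely many terms equal [a], or infinitely many lie below [a] and, by
    minimality, eventually exceed any given one of them. *)
Lemma omega1_subseq (r : nat -> omega1) :
  exists2 k : nat -> nat, increasing_seq k &
    (exists b, forall j, r (k j) = b) \/ increasing_seq (r \o k).
Proof.
have [a0 ra0] := omega1_bound r.
have [|a aI amin] :=
    @omega1_least [set a | forall n, exists2 i, (n <= i)%N & r i <= a].
  by exists a0 => n; exists n => //; exact: ltW.
have [ca|/existsNP[n0 nca]] :=
    pselect (forall n, exists2 i, (n <= i)%N & r i = a).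
  have [|k kI rk] := @increasing_choice (fun _ i => r i = a).
    by move=> _ n; exact: ca.
  by exists k => //; left; exists a.
have rare n : exists2 i, (n <= i)%N & r i < a.
  have [i ni ia] := aI (maxn n n0); exists i.
    exact: leq_trans (leq_maxl _ _) ni.
  rewrite lt_neqAle ia andbT; apply/eqP => ri; apply: nca; exists i => //.
  exact: leq_trans (leq_maxr _ _) ni.
have /choice[g gP] : forall m, exists m',
    [/\ (m < m')%N, r m' < a & r m < a -> r m < r m'].
  move=> m; have [ma|ma] := ltP (r m) a; last first.
    by have [i mi ia] := rare m.+1; exists i.
  have [n rn] : exists n, forall i, (n <= i)%N -> r m < r i.
    apply: contrapT => nn; have : a <= r m; last by rewrite leNgt ma.
    apply: amin => n; apply: contrapT => nle; apply: nn; exists n => i ni.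
    by rewrite ltNge; apply/negP => im; apply: nle; exists i.
  have [i] := rare (maxn m.+1 n); rewrite geq_max => /andP[mi ni] ia.
  by exists i; split=> // _; exact: rn.
(* [r 0] may exceed [a]; one application of [g] brings the value below [a]. *)
pose k j := iter j.+1 g 0%N.
have ka j : r (k j) < a by rewrite /k iterS; have [] := gP (iter j g 0%N).
exists k; first by apply/increasing_seqP => j; have [] := gP (k j).
by right; apply/increasing_seqP => j; have [_ _] := gP (k j); exact.
Qed.

End Omega1.

(** * H-covering maps are stable *)

Definition avoids {R : realType} {X Y : metricType R} (f : X -> Y)
    (a : omega1) (y : Y) (S : set Y) (c : canonical_compact a y S)
    (U : set X) : Prop :=
  forall A K, associated c A -> homeo_lift f K A ->
    K `&` f @^-1` [set y] `<=` ~` U.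

(** Bad compacta are required in every neighborhood of [y] so that they can be
    placed in the disjoint neighborhoods of a separated sequence. *)
Definition bad {R : realType} {X Y : metricType R} (f : X -> Y) (y : Y)
    (U : set X) : Prop :=
  forall N, nbhs y N ->
    exists a S (c : canonical_compact a y S), S `<=` N /\ avoids f c U.

Section CoveringToStable.
Context {R : realType} {X Y : metricType R} (f : X -> Y).

(** The points of [K] over the base points [D (k j)] tend to [x], so one of
    them is in [V]; restrict the lift to the block of that base point. *)
Lemma fan_lift_near (y : Y) (D : nat -> Y) (k : nat -> nat) (T : nat -> set Y)
    (K V : set X) (x : X) :
  D @ \oo --> y -> increasing_seq k -> (forall j, T j (D (k j))) ->
  homeo_lift f K ([set y] `|` \bigcup_j T j) ->
  K x -> f x = y -> nbhs x V ->
  exists j K', homeo_lift f K' (T j) /\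
    (K' `&` f @^-1` [set D (k j)] `&` V) !=set0.
Proof.
move=> Dy kI TD lK Kx fx nV.
have [_ loc] := lK; have := loc x V Kx nV; rewrite fx => nw.
have [j _ nj] := cvg_subseq kI Dy nw; have KV := nj j (leqnn j).
have TA : T j `<=` [set y] `|` \bigcup_j T j by move=> w Tw; right; exists j.
have := homeo_lift_sub lK TA; exists j, (K `&` f @^-1` T j); split=> //.
have [KA _] := lK; have : (f @` K) (D (k j)) by rewrite KA; exact: TA.
move=> [q Kq fq]; exists q; split; last by apply: KV; split.
by split=> //; split=> //=; rewrite fq.
Qed.

(** After thinning, the ranks of the blocks are constant, which gives a
    compactum of successor rank, or increasing, which gives one of limit rank;
    [fan_lift_near] excludes lifts meeting [U] in both cases. *)
Lemma bad_fan (y : Y) (D : nat -> Y) (O : nat -> set Y) (U V : set X) :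
  separated_sequence y D O -> open V -> U `&` f @^-1` [set y] `<=` V ->
  (forall i, exists a S (c : canonical_compact a (D i) S),
    S `<=` O i /\ avoids f c V) ->
  exists a S (c : canonical_compact a y S),
    S `<=` [set y] `|` \bigcup_i O i /\ avoids f c U.
Proof.
move=> sD oV UV /choice[r /choice[S rSc]].
have [k kI] := omega1_subseq r.
have sDk := separated_subseq kI sD.
have [_ Dky _ _] := sDk.
have SO i : S i `<=` O i by have [c []] := rSc i.
have SN : [set y] `|` \bigcup_j S (k j) `<=` [set y] `|` \bigcup_i O i.
  by apply: setUS => p [j _ Sp]; exists (k j) => //; exact: SO.
have avoidsU (b : nat -> omega1)
    (c : forall j, canonical_compact (b j) (D (k j)) (S (k j))) A K :
  (forall j, avoids f (c j) V) -> fan y (fun j => associated (c j)) A ->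
  homeo_lift f K A -> K `&` f @^-1` [set y] `<=` ~` U.
  move=> cV [l [T [lI cT ->]]] lK x [Kx fx] Ux.
  have nV : nbhs x V.
    by apply: open_nbhs_nbhs; split=> //; apply: UV; split.
  have TD j : T j (D (k (l j))) by exact: associated_base (cT j).
  have [j [K' [lK' [q [[K'q fq] Vq]]]]] := fan_lift_near Dky lI TD lK Kx fx nV.
  exact: (cV _ _ _ (cT j) lK' q).
case=> [[b rb]|rI].
  have /(_ _)/cid cb j : exists c : canonical_compact b (D (k j)) (S (k j)),
      avoids f c V.
    by rewrite -(rb j); have [c []] := rSc (k j); exists c.
  have [a ba] := omega1_succ b.
  have b0 : ~ is_zero b by have [c _] := cb 0%N; exact: canonical_neq0 c.
  exists a, _, (canonical_succ ba b0 sDk (fun j => sval (cb j))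
    (fun j => SO (k j))); split=> // A K /=.
  exact: (avoidsU (fun=> b) (fun j => sval (cb j)) A K (fun j => svalP (cb j))).
have /(_ _)/cid cb j :
    exists c : canonical_compact (r (k j)) (D (k j)) (S (k j)), avoids f c V.
  by have [c []] := rSc (k j); exists c.
have [a alim ra] := omega1_limit rI.
have rk0 j : ~ is_zero (r (k j)) /\ (r (k j) < a)%O.
  by split; [have [c _] := cb j; exact: canonical_neq0 c|exact: ra].
exists a, _, (canonical_limit alim rI rk0 sDk (fun j => sval (cb j))
  (fun j => SO (k j))); split=> // A K /=.
exact: (avoidsU (r \o k) (fun j => sval (cb j)) A K (fun j => svalP (cb j))).
Qed.

(** Badness of [V] near [y] passes to [U].  If [V] is bad at [y] itself, this
    is monotonicity; otherwise the points near [y] where [V] is bad differ from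
    [y], so they contain a separated sequence. *)
Lemma bad_open (y : Y) (U V : set X) : open V -> U `&` f @^-1` [set y] `<=` V ->
  ~ (\forall w \near y, ~ bad f w V) -> bad f y U.
Proof.
move=> oV UV nV N nN.
have [By|nBy] := pselect (bad f y V).
  have [a [S [c [SN cV]]]] := By N nN; exists a, S, c; split=> // A K cA lK.
  by move=> x [Kx fx] Ux; apply: (cV A K cA lK x) => //; apply: UV.
have By : limit_point [set w | bad f w V] y.
  move=> M nM; apply: contrapT => nw; apply: nV; apply: filterS nM => w Mw bw.
  have [wy|wy] := eqVneq w y; first by apply: nBy; rewrite -wy.
  by apply: nw; exists w.
have [D [B [sD DB]]] := separated_in By nN.
have badO i : exists a S (c : canonical_compact a (D i) S),
    S `<=` B i /\ avoids f c V.
  by have [+ _] := DB i; apply; have [_ _ _ /(_ i)[]] := sD.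
have [a [S [c [SO cU]]]] := bad_fan sD oV UV badO.
exists a, S, c; split=> //; apply: subset_trans SO _.
by move=> p [->|[i _]]; [exact: nbhs_singleton|have [_] := DB i; apply].
Qed.

(** Every compactum avoids such a [U]; one exists in each neighborhood of [y]
    because [y] is not isolated. *)
Lemma bad_disjoint (y : Y) (U : set X) : isolated [set: Y] = set0 ->
  ~ (U `&` f @^-1` [set y] !=set0) -> bad f y U.
Proof.
move=> hY U0 N nN.
have yl : limit_point [set: Y] y.
  have : closure [set: Y] y by exact: subset_closure.
  by rewrite closure_isolated_limit_point hY set0U.
have [D [B [sD DB]]] := separated_in yl nN.
have [a a1] := omega1_one.
exists a, _, (canonical_one a1 sD); split.
  move=> p [->|[i _ <-]]; first exact: nbhs_singleton.
  by have [_] := DB i; apply; exact: mem_separated sD.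
by move=> A K _ _ x [Kx fx] Ux; apply: U0; exists x.
Qed.

Lemma H_covering_stable : isolated [set: Y] = set0 -> continuous f ->
  H_covering f -> stable f.
Proof.
move=> hY cf Hf; exists (fun y => [set U | ~ bad f y U]); split.
- move=> y; exists setT => /(_ setT filterT)[a [S [c [_ cT]]]].
  have [A [K [cA KA]]] := Hf a (canonical_neq0 c) y S c.
  have [[_ _ fS] _ _] := KA; have [p Kp fp] := fS y (associated_base cA).
  have lK : homeo_lift f K A.
    by apply/homeo_liftP => //; [exact: metric_hausdorff|exists p].
  exact: (cT A K cA lK p).
- by move=> y U nU; apply: contrapT => /(bad_disjoint hY).
- by move=> y U V nU oV UV; apply: contrapT => /(bad_open oV UV).
Qed.

End CoveringToStable.

Theorem corollary5p1 (R : realType) (X Y : metricType R) (f : X -> Y)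
    (hY : isolated [set: Y] = set0)
    (fcont : continuous f)
    (fsurj : forall y : Y, exists x : X, f x = y) :
  H_covering f <-> stable f.
Proof.
by split; [exact: H_covering_stable|exact: stable_H_covering].
Qed.
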